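(* Consider the flexible spacecraft system with constant desired attitude $q_d\in\mathbb{Q}_u$, a disturbance $d$ of the stated multi-tone form, and all associated objects defined in the context. Consider the augmented system (with $\omega_e=\omega$) $$\begin{aligned} J\dot{\omega}_e&=F_1(\omega_e)\mu+\tilde{u}+\Psi T^{-1}(\sigma)(\check{v}+N\delta\dot{\eta}+NJ\omega_e)-\Psi T^{-1}(\sigma)v-\delta\ddot{\eta},\\ \dot{\check{v}}&=M\check{v}+MN\delta\dot{\eta}+(MNL_1(\omega_e)-NF_1(\omega_e))\mu,\\ \ddot{\eta}&=-C\dot{\eta}-K\eta-\delta^{T}\dot{\omega}_e,\\ \dot{q}_e&=\tfrac12\begin{bmatrix} q_{e4}I_3+q_{ev}^{\times}\\ -q_{ev}^{T}\end{bmatrix}\omega_e, \end{aligned}$$ which results from the coordinate and input transformation $\check v=v-\theta-N\delta\dot\eta-NJ\omega_e$, $\tilde u=u+F_0(\omega_e)$, where $v\in\mathbb{R}^r$ is the state of the internal model $\dot v=Mv+Nu+NF_0(\omega_e)-MNL_0(\omega_e)$. Suppose there exists a dynamic control law $$\tilde u=h(\bar\chi,q_e,\omega_e),\qquad \dot{\bar\chi}=k(\bar\chi,q_e,\omega_e),$$ with $\bar\chi\in\mathbb{R}^{n_{\bar\chi}}$ and $h,k$ sufficiently smooth functions, such that for any initial state $q(0)\in\mathbb{Q}_u$, $\omega(0)\in\mathbb{R}^3$, $\eta(0)\in\mathbb{R}^n$, $\bar\chi(0)\in\mathbb{R}^{n_{\bar\chi}}$ (and any initial values of $\dot\eta$ and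 $v$), the state of the system composed of the augmented system and this control law is bounded on $[0,\infty)$ and $\lim_{t\to\infty}(q_{ev}(t),\omega_e(t),\eta(t))=(0,0,0)$. Then the attitude tracking problem (defined in the context) is solved by the control law $$\begin{aligned} u&=h(\bar\chi,q_e,\omega_e)-F_0(\omega_e),\\ \dot v&=Mv+Nu+NF_0(\omega_e)-MNL_0(\omega_e),\\ \dot{\bar\chi}&=k(\bar\chi,q_e,\omega_e). \end{aligned}$$
   Context: **Spacecraft.** For $x\in\mathbb{R}^3$, $x^\times=\begin{bmatrix}0&-x_3&x_2\\ x_3&0&-x_1\\ -x_2&x_1&0\end{bmatrix}$. $\mathbb{Q}_u$ is the set of unit quaternions $q=[q_v^T,q_4]^T$, $q_v\in\mathbb{R}^3$, $q_4\in\mathbb{R}$, $q_v^Tq_v+q_4^2=1$. The flexible spacecraft is $$\dot q=\tfrac12\begin{bmatrix}q_v^\times+q_4I_3\\-q_v^T\end{bmatrix}\omega,\quad J\dot\omega+\omega^\times J\omega+\delta\ddot\eta=u+d,\quad \ddot\eta+C\dot\eta+K\eta=-\delta^T\dot\omega,$$ with $q\in\mathbb{Q}_u$, $\omega\in\mathbb{R}^3$, control torque $u\in\mathbb{R}^3$, $\eta\in\mathbb{R}^n$, $\delta\in\mathbb{R}^{3\times n}$, inertia matrix $J\in\mathbb{R}^{3\times3}$ symmetric positive definite (uncertain), $C,K\in\mathbb{R}^{n\times n}$ symmetric positive definite. **Disturbance.** $d=[d_1,d_2,d_3]^T$ with $d_i(t)=C_{i0}+\sum_{j=1}^{m_i}C_{ij}\sin(b_{ij}t+l_{ij})$,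 with unknown real constants $C_{i0},C_{ij},b_{ij},l_{ij}$; $\sigma$ is the vector of all unknown frequencies. **Error variables.** $q_d=[q_{dv}^T,q_{d4}]^T\in\mathbb{Q}_u$ is constant and the desired angular velocity is $\omega_d=0$. $q_e=[q_{ev}^T,q_{e4}]^T$ with $q_{ev}=q_{d4}q_v-q_{dv}^\times q_v-q_4q_{dv}$, $q_{e4}=q_{dv}^Tq_v+q_4q_{d4}$; $\omega_e=\omega$. **Attitude tracking problem.** A dynamic control law $u=\phi(\chi,q,q_d,\omega,\omega_d)$, $\dot\chi=\psi(\chi,q,q_d,\omega,\omega_d)$ with $\phi,\psi$ sufficiently smooth solves the problem if, for the disturbances $d=[d_1,d_2,d_3]^T$ of the form $d_i(t)=C_{i0}+\sum_{j=1}^{m_i}C_{ij}\sin(b_{ij}t+l_{ij})$, $i=1,2,3$, and every initial state of the plant (with $q(0)\in\mathbb{Q}_u$) and of $\chi$, the closed-loop solution is bounded on $[0,\infty)$ and $\lim_{t\to\infty}(q_{ev}(t),\omega_e(t),\eta(t))=(0,0,0)$ (the attitude tracks the desired one exactly when $q_{ev}=0$). **Parameterization of $J$.** $\mu\in\mathbb{R}^{n_\mu}$, $0\le n_\mu\le 6$, is an unknown constant vector and $L_0(x)\in\mathbb{R}^3$, $L_1(x)\in\mathbb{R}^{3\times n_\mu}$ are known, linear in $x\in\mathbb{R}^3$, with $Jx=L_1(x)\mu+L_0(x)$ for all $x$. (Concretely, $L_1(x)=L(x)\bar L_1$ and $L_0(x)=L(x)\bar L_0$, where $Jx=L(x)[J_{11},J_{22},J_{33},J_{23},J_{13},J_{12}]^T$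 and $[J_{11},J_{22},J_{33},J_{23},J_{13},J_{12}]^T=\bar L_1\mu+\bar L_0$ with $\bar L_1,\bar L_0$ known constant matrices.) Set $F_i(x)=-x^\times L_i(x)$, $i=0,1$, so $-x^\times Jx=F_1(x)\mu+F_0(x)$. **Internal model data.** For $i=1,2,3$ there are a positive integer $r_i$ and reals $a_{i1}(\sigma),\dots,a_{ir_i}(\sigma)$ with $d_i^{(r_i)}=\sum_{j=1}^{r_i}a_{ij}(\sigma)d_i^{(j-1)}$, such that all roots of $\lambda^{r_i}-a_{i1}(\sigma)-a_{i2}(\sigma)\lambda-\cdots-a_{ir_i}(\sigma)\lambda^{r_i-1}$ are distinct with zero real parts. $\Phi_i(\sigma)$ is the $r_i\times r_i$ companion matrix with ones on the superdiagonal, last row $(a_{i1}(\sigma),\dots,a_{ir_i}(\sigma))$ and zeros elsewhere; $\Psi_i=[1,0,\dots,0]\in\mathbb{R}^{1\times r_i}$; $\varrho_i=[d_i,\dot d_i,\dots,d_i^{(r_i-1)}]^T$, so $\dot\varrho_i=\Phi_i(\sigma)\varrho_i$, $d_i=\Psi_i\varrho_i$. $M_i\in\mathbb{R}^{r_i\times r_i}$ is Hurwitz, $N_i\in\mathbb{R}^{r_i}$, $(M_i,N_i)$ controllable; $T_i(\sigma)$ is the nonsingular solution of $T_i(\sigma)\Phi_i(\sigma)-M_iT_i(\sigma)=N_i\Psi_i$. $\theta_i=-T_i(\sigma)\varrho_i$, $\theta=\mathrm{col}(\theta_1,\theta_2,\theta_3)$; $M,N,\Psi,T(\sigma)$ are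 the block diagonal matrices with diagonal blocks $M_i$, $N_i$, $\Psi_i$, $T_i(\sigma)$ ($i=1,2,3$) respectively; $r=r_1+r_2+r_3$. *)

(* Defs.v *)
From mathcomp Require Export all_boot all_order all_algebra.
From mathcomp Require Export all_classical all_reals all_analysis.
From mathcomp Require Export complex.
Set Implicit Arguments.
Unset Strict Implicit.
Unset Printing Implicit Defensive.
Import Order.TTheory GRing.Theory Num.Theory.
Import numFieldNormedType.Exports.
Local Open Scope classical_set_scope.
Local Open Scope ring_scope.

(* A solution of an ODE on [0, oo) is a path that is continuous on [0, oo),
   differentiable on (0, oo), and satisfies the equations on (0, oo).  For an
   ODE with continuous right-hand side the one-sided equation at 0 follows.
   Values of paths at negative times are irrelevant. *)
Definition ode_path (R : realType) (V : normedModType R) (x : R -> V) : Prop :=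
  {within `[0, +oo[, continuous x} /\ (forall t, 0 < t -> derivable x t 1).

Definition bounded_path (R : realType) (V : normedModType R) (x : R -> V) :
  Prop := [bounded x t | t in `[0, +oo[].

(* Maps of class C^p between (finite-dimensional) spaces: f is C^(p+1) when it
   is differentiable and all its directional derivatives are C^p. *)
Fixpoint classC (R : realType) (V W : normedModType R) (p : nat) (f : V -> W) :
    Prop :=
  match p with
  | 0 => continuous f
  | p'.+1 => (forall x, differentiable f x) /\
             (forall w, classC p' (fun x => 'D_w f x))
  end.

Section Kinematics.
Variable R : realType.
Implicit Types (x w : 'cV[R]_3) (q qd : 'cV[R]_(3 + 1)).

Definition cross_mx x : 'M[R]_3 := \matrix_(i, j)
  nth 0 (nth [::] [:: [:: 0; - x 2%:R 0; x 1 0];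
                      [:: x 2%:R 0; 0; - x 0 0];
                      [:: - x 1 0; x 0 0; 0]] i) j.

Definition qvec q : 'cV[R]_3 := usubmx q.
Definition qscal q : R := dsubmx q 0 0.
Definition quat (v : 'cV[R]_3) (s : R) : 'cV[R]_(3 + 1) := col_mx v s%:M.

Definition unit_quat : set 'cV[R]_(3 + 1) :=
  [set q | ((qvec q)^T *m qvec q) 0 0 + qscal q ^+ 2 = 1].

Definition quat_rate q w : 'cV[R]_(3 + 1) :=
  2^-1 *: (col_mx (cross_mx (qvec q) + (qscal q)%:M) (- (qvec q)^T) *m w).

Definition quat_err qd q : 'cV[R]_(3 + 1) :=
  quat (qscal qd *: qvec q - cross_mx (qvec qd) *m qvec q
          - qscal q *: qvec qd)
       (((qvec qd)^T *m qvec q) 0 0 + qscal q * qscal qd).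

End Kinematics.

Definition sym_posdef (R : realType) (n : nat) (A : 'M[R]_n) : Prop :=
  A^T = A /\ (forall x : 'cV[R]_n, x != 0 -> 0 < (x^T *m A *m x) 0 0).

Record spacecraft (R : realType) (n : nat) := Spacecraft {
  inertia : 'M[R]_3;
  coupling : 'M[R]_(3, n);
  damping : 'M[R]_n;
  stiffness : 'M[R]_n;
  inertia_spd : sym_posdef inertia;
  damping_spd : sym_posdef damping;
  stiffness_spd : sym_posdef stiffness }.

Record disturbance (R : realType) (m : 'I_3 -> nat) := Disturbance {
  bias : 'I_3 -> R;
  ampl : forall i, 'I_(m i) -> R;
  freq : forall i, 'I_(m i) -> R;
  phase : forall i, 'I_(m i) -> R }.

Definition dist_coord (R : realType) (m : 'I_3 -> nat) (d : disturbance R m)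
    (i : 'I_3) (t : R) : R :=
  bias d i + \sum_(j < m i) ampl d j * sin (freq d j * t + phase d j).

Definition dist (R : realType) (m : 'I_3 -> nat) (d : disturbance R m) (t : R) :
  'cV[R]_3 := \col_i dist_coord d i t.

(* The vector sigma of all the disturbance frequencies. *)
Definition freqs (R : realType) (m : 'I_3 -> nat) :=
  forall i, 'I_(m i) -> R.

Section TrackingProblem.
Variables (R : realType) (n k : nat).

(* The second-order mode equation is written in first-order form, with
   [mode_rate] standing for the derivative of [mode]. *)
Record plant_path := PlantPath {
  att : R -> 'cV[R]_(3 + 1);
  vel : R -> 'cV[R]_3;
  mode : R -> 'cV[R]_n;
  mode_rate : R -> 'cV[R]_n }.

(* Arguments (chi, q, q_d, omega, omega_d) of a control law. *)
Definition ctrl_arg : normedModType R :=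
  ('cV[R]_k * 'cV[R]_(3 + 1) * 'cV[R]_(3 + 1) * 'cV[R]_3 * 'cV[R]_3)%type.

Definition closed_loop (P : spacecraft R n) (dt : R -> 'cV[R]_3)
    (qd : 'cV[R]_(3 + 1)) (phi : ctrl_arg -> 'cV[R]_3)
    (psi : ctrl_arg -> 'cV[R]_k) (x : plant_path) (chi : R -> 'cV[R]_k) :
    Prop :=
  let: PlantPath q w eta zeta := x in
  [/\ ode_path q, ode_path w, ode_path eta, ode_path zeta & ode_path chi] /\
  forall t, 0 < t ->
  let a : ctrl_arg := (chi t, q t, qd, w t, 0) in
  [/\ q^`()%classic t = quat_rate (q t) (w t),
      inertia P *m w^`()%classic t + cross_mx (w t) *m (inertia P *m w t)
        + coupling P *m zeta^`()%classic t = phi a + dt t,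
      eta^`()%classic t = zeta t,
      zeta^`()%classic t + damping P *m zeta t + stiffness P *m eta t
        = - (coupling P)^T *m w^`()%classic t
    & chi^`()%classic t = psi a].

(* [p] is the order of smoothness required of the control law, and [D] is the
   set of disturbances under consideration. *)
Definition solves_attitude_tracking (p : nat) (P : spacecraft R n)
    (m : 'I_3 -> nat) (D : set (disturbance R m)) (qd : 'cV[R]_(3 + 1))
    (phi : ctrl_arg -> 'cV[R]_3) (psi : ctrl_arg -> 'cV[R]_k) : Prop :=
  [/\ classC p phi, classC p psi &
  forall d, D d ->
  forall (q0 : 'cV[R]_(3 + 1)) (w0 : 'cV[R]_3) (eta0 zeta0 : 'cV[R]_n)
    (chi0 : 'cV[R]_k), unit_quat q0 ->
  let sol x chi := closed_loop P (dist d) qd phi psi x chi /\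
    [/\ att x 0 = q0, vel x 0 = w0, mode x 0 = eta0, mode_rate x 0 = zeta0
      & chi 0 = chi0] in
  (exists x chi, sol x chi) /\
  forall x chi, sol x chi ->
  [/\ bounded_path (att x), bounded_path (vel x), bounded_path (mode x),
      bounded_path (mode_rate x) & bounded_path chi] /\
  [/\ (fun t => qvec (quat_err qd (att x t))) @ +oo --> (0 : 'cV[R]_3),
      vel x @ +oo --> (0 : 'cV[R]_3)
    & mode x @ +oo --> (0 : 'cV[R]_n)]].

End TrackingProblem.

Definition hurwitz (R : realType) (r : nat) (A : 'M[R]_r) : Prop :=
  forall z : R[i], eigenvalue (map_mx (real_complex R) A) z ->
    complex.Re z < 0.

Definition controllable (R : realType) (r : nat) (A : 'M[R]_r) (B : 'cV[R]_r) :
    Prop :=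
  forall x0 x1 : 'cV[R]_r,
  exists (tf : R) (u : R -> R) (x : R -> 'cV[R]_r),
  [/\ 0 < tf, continuous u,
      forall t : R, is_derive t 1 x (A *m x t + u t *: B),
      x 0 = x0 & x tf = x1].

Section InternalModel.
Variable R : realType.

(* With 0-based indices, [a j] is the coefficient of the j-th derivative. *)
Definition char_pol (r : nat) (a : 'I_r -> R) : {poly R} :=
  'X^r - \sum_(j < r) a j *: 'X^j.

Definition simple_imaginary_roots (p : {poly R}) : Prop :=
  exists s : seq R[i],
    [/\ map_poly (real_complex R) p = \prod_(z <- s) ('X - z%:P),
        uniq s & forall z, z \in s -> complex.Re z = 0].

Definition companion (r : nat) (a : 'I_r -> R) : 'M[R]_r :=
  \matrix_(i, j) if i.+1 == r then a j else (j == i.+1 :> nat)%:R.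

Definition first_row (r : nat) : 'rV[R]_r := \row_j (j == 0%N :> nat)%:R.

Variable r : 'I_3 -> nat.

Definition dist_ode (m : 'I_3 -> nat) (d : disturbance R m)
    (a : forall i, 'I_(r i) -> R) : Prop :=
  forall i t, derive1n (r i) (dist_coord d i) t
    = \sum_(j < r i) a i j * derive1n j (dist_coord d i) t.

Definition varrho (m : 'I_3 -> nat) (d : disturbance R m) (i : 'I_3) (t : R) :
  'cV[R]_(r i) := \col_j derive1n j (dist_coord d i) t.

Definition theta (m : 'I_3 -> nat) (d : disturbance R m)
    (T : forall i, 'M[R]_(r i)) (t : R) : 'cV[R]_(\sum_i r i) :=
  \mxcol_i (- T i *m varrho d i t).

(* Block diagonal matrices whose diagonal blocks are the columns [N i],
   respectively the rows [first_row (r i)]. *)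
Definition blockN (N : forall i, 'cV[R]_(r i)) : 'M[R]_(\sum_i r i, 3) :=
  \mxcol_i (N i *m delta_mx 0 i).
Definition blockPsi : 'M[R]_(3, \sum_i r i) :=
  \mxrow_i (delta_mx i 0 *m first_row (r i)).

End InternalModel.

Definition Ffun (R : realType) (c : nat) (L : 'cV[R]_3 -> 'M[R]_(3, c))
    (x : 'cV[R]_3) : 'M[R]_(3, c) := - cross_mx x *m L x.

Section Augmented.
Variables (R : realType) (n nmu nchi : nat) (r : 'I_3 -> nat).

Record aug_path := AugPath {
  aug_err : R -> 'cV[R]_(3 + 1);
  aug_vel : R -> 'cV[R]_3;
  aug_mode : R -> 'cV[R]_n;
  aug_mode_rate : R -> 'cV[R]_n;
  aug_vcheck : R -> 'cV[R]_(\sum_i r i);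
  aug_v : R -> 'cV[R]_(\sum_i r i);
  aug_chi : R -> 'cV[R]_nchi }.

(* Arguments (chibar, q_e, omega_e) of the control law. *)
Definition reg_arg : normedModType R :=
  ('cV[R]_nchi * 'cV[R]_(3 + 1) * 'cV[R]_3)%type.

Variables (P : spacecraft R n) (qd : 'cV[R]_(3 + 1)).
Variables (mu : 'cV[R]_nmu) (L0 : 'cV[R]_3 -> 'cV[R]_3)
  (L1 : 'cV[R]_3 -> 'M[R]_(3, nmu)).
Variables (M : forall i, 'M[R]_(r i)) (N : forall i, 'cV[R]_(r i)).
Variables (h : reg_arg -> 'cV[R]_3) (kk : reg_arg -> 'cV[R]_nchi).

Definition im_rate (v : 'cV[R]_(\sum_i r i)) (u w : 'cV[R]_3) :
    'cV[R]_(\sum_i r i) :=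
  (\mxdiag_i M i) *m v + blockN N *m u + blockN N *m Ffun L0 w
    - (\mxdiag_i M i) *m blockN N *m L0 w.

(* The augmented system, with T = T(sigma), in closed loop with u~ = h and
   chibar' = k; the signal v evolves by the internal model, in which
   u = u~ - F_0. *)
Definition aug_closed_loop (T : forall i, 'M[R]_(r i)) (x : aug_path) : Prop :=
  let: AugPath qe w eta zeta vc v chi := x in
  let J := inertia P in let delta := coupling P in
  let MM := \mxdiag_i M i in let NN := blockN N in
  let PsiTinv := blockPsi R r *m invmx (\mxdiag_i T i) in
  [/\ ode_path qe, ode_path w, ode_path eta & ode_path zeta] /\
  [/\ ode_path vc, ode_path v & ode_path chi] /\
  forall t, 0 < t ->
  let ut := h (chi t, qe t, w t) in
  [/\ J *m w^`()%classic t = Ffun L1 (w t) *m mu + ut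
        + PsiTinv *m (vc t + NN *m delta *m zeta t + NN *m J *m w t)
        - PsiTinv *m v t - delta *m zeta^`()%classic t,
      vc^`()%classic t = MM *m vc t + MM *m NN *m delta *m zeta t
        + (MM *m NN *m L1 (w t) - NN *m Ffun L1 (w t)) *m mu,
      eta^`()%classic t = zeta t /\
      zeta^`()%classic t = - damping P *m zeta t - stiffness P *m eta t
        - delta^T *m w^`()%classic t,
      qe^`()%classic t = quat_rate (qe t) (w t)
    & v^`()%classic t = im_rate (v t) (ut - Ffun L0 (w t)) (w t) /\
      chi^`()%classic t = kk (chi t, qe t, w t)].

(* The initial value of vcheck is the one given by the coordinate
   transformation. *)
Definition stabilizes_augmented (m : 'I_3 -> nat) (D : set (disturbance R m))
    (T : freqs R m -> forall i, 'M[R]_(r i)) : Prop :=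
  forall d, D d ->
  forall (q0 : 'cV[R]_(3 + 1)) (w0 : 'cV[R]_3) (eta0 zeta0 : 'cV[R]_n)
    (v0 : 'cV[R]_(\sum_i r i)) (chi0 : 'cV[R]_nchi), unit_quat q0 ->
  let sol x := aug_closed_loop (T (@freq R m d)) x /\
    [/\ aug_err x 0 = quat_err qd q0 /\ aug_vel x 0 = w0, aug_mode x 0 = eta0,
        aug_mode_rate x 0 = zeta0,
        aug_vcheck x 0 = v0 - theta d (T (@freq R m d)) 0
          - blockN N *m coupling P *m zeta0 - blockN N *m inertia P *m w0
      & aug_v x 0 = v0 /\ aug_chi x 0 = chi0] in
  (exists x, sol x) /\
  forall x, sol x ->
  [/\ bounded_path (aug_err x), bounded_path (aug_vel x),
      bounded_path (aug_mode x) & bounded_path (aug_mode_rate x)] /\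
  [/\ bounded_path (aug_vcheck x), bounded_path (aug_v x)
    & bounded_path (aug_chi x)] /\
  [/\ (fun t => qvec (aug_err x t)) @ +oo --> (0 : 'cV[R]_3),
      aug_vel x @ +oo --> (0 : 'cV[R]_3)
    & aug_mode x @ +oo --> (0 : 'cV[R]_n)].

(* The control law for the original plant, with state chi = col(v, chibar).
   Since omega_d = 0 it uses omega_e = omega. *)
Definition law_out
    (a : ctrl_arg R (\sum_i r i + nchi)) : 'cV[R]_3 :=
  let: (chi, q, qdes, w, _) := a in
  h (dsubmx chi, quat_err qdes q, w) - Ffun L0 w.

Definition law_dyn
    (a : ctrl_arg R (\sum_i r i + nchi)) : 'cV[R]_(\sum_i r i + nchi) :=
  let: (chi, q, qdes, w, _) := a in
  col_mx (im_rate (usubmx chi) (law_out a) w)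
         (kk (dsubmx chi, quat_err qdes q, w)).

End Augmented.

(* Main.v *)
Require Import Defs.
From HB Require Import structures.
From mathcomp Require Import ring lra.
Set Implicit Arguments.
Unset Strict Implicit.
Unset Printing Implicit Defensive.
Import Order.TTheory GRing.Theory Num.Theory.
Import numFieldNormedType.Exports.
Local Open Scope classical_set_scope.
Local Open Scope ring_scope.

(** The closed loop formed by the spacecraft and the internal model is the
augmented system seen in other coordinates, so stability of the latter passes
to the former.

Two facts about the steady state [theta] of the internal model carry the
change of coordinates: [path_theta], theta' = M theta - N d, a restatement of
the Sylvester equation T Phi - M T = N Psi along the disturbance, and
[PsiTinv_theta], Psi T^-1 theta = - d, which says that the disturbance can be
read off from [theta].  Substituting them, together with
F_1 mu + F_0 = - w^x J w, into a solution of the closed loop shows that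
vcheck = v - theta - N delta eta' - N J w completes it to a solution of the
augmented system ([augment_closed_loop]).  Boundedness and convergence
of every closed-loop solution follow.

For the existence of a closed-loop solution one starts from a solution of the
augmented system, whose component vcheck is an independent unknown.  Its
deviation e from v - theta - N delta eta' - N J w vanishes at time 0 and obeys
the linear equation e' = (M + N Psi T^-1) e, so it vanishes identically
([linear_ode_unique], a Gronwall argument), and the augmented
equations turn back into those of the plant ([plant_of_closed_loop]).

On the attitude side, [quat_err] is multiplication by the conjugate of the
desired unit quaternion: it is linear, commutes with the kinematics
([quat_err_rate]) and is undone by multiplication by the desired quaternion
([quat_errK], [quat_err_conjK]).

The control law is as smooth as [h] and [k] because it composes them
with polynomial maps.  As [classC] is defined through directional derivatives,
the chain rule [classC_comp] expands the inner derivative in a finite basis of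
the intermediate space. *)

(** * Closure properties of maps of class C^p *)

Lemma linear_diff (R : realType) (V W : normedModType R) (f : V -> W) (x : V) :
  linear f -> continuous f -> differentiable f x /\ 'd f x = f :> (V -> W).
Proof.
move=> lf cf.
pose fM := GRing.isLinear.Build _ _ _ _ f lf.
pose fL : {linear V -> W} := HB.pack f fM.
by split; [exact: (@linear_differentiable _ _ _ fL)|exact: (@diff_lin _ _ _ fL)].
Qed.

Lemma linear_coord (R : realType) m n (i : 'I_m) (j : 'I_n) :
  linear (fun x : 'M[R]_(m, n) => x i j).
Proof. by move=> a x y; rewrite !mxE. Qed.

Section Smooth.
Variable R : realType.
Implicit Types U V W : normedModType R.

Lemma classC_cst V W p (c : W) : classC p (fun _ : V => c).
Proof.
elim: p c => [|p IHp] c /=; first exact: cst_continuous.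
split=> [x|w]; first exact: differentiable_cst.
rewrite [X in classC p X](_ : _ = fun=> 0); first exact: IHp.
by apply/funext => x; exact: derive_cst.
Qed.

Lemma classC_linear V W p (f : V -> W) : linear f -> continuous f -> classC p f.
Proof.
move=> lf cf; case: p => [//|p] /=; split=> [x|w].
  by have [] := linear_diff x lf cf.
rewrite [X in classC p X](_ : _ = fun=> f w); first exact: classC_cst.
apply/funext => x; have [df dE] := linear_diff x lf cf.
by rewrite deriveE// dE.
Qed.

Lemma classC_comp_linear U V W p (g : V -> W) (f : U -> V) :
  linear g -> continuous g -> classC p f -> classC p (fun x => g (f x)).
Proof.
move=> lg cg; elim: p f => [|p IHp] f /=.
  by move=> cf x; apply: continuous_comp; [exact: cf|exact: cg].
move=> [df Df]; split=> [x|w].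
  by apply: differentiable_comp => //; have [] := linear_diff (f x) lg cg.
rewrite [X in classC p X](_ : _ = fun x => g ('D_w f x)); first exact: IHp.
apply/funext => x; have [dg dgE] := linear_diff (f x) lg cg.
by rewrite !deriveE//; [rewrite diff_comp//= dgE|exact: differentiable_comp].
Qed.

Lemma classC_pred V W p (f : V -> W) : classC p.+1 f -> classC p f.
Proof.
elim: p f => [|p IHp] f.
  by move=> [df _] x; exact: differentiable_continuous.
by move=> [df Df]; split=> // w; apply: IHp; exact: Df.
Qed.

Lemma classC_add V W p (f g : V -> W) :
  classC p f -> classC p g -> classC p (fun x => f x + g x).
Proof.
elim: p f g => [|p IHp] f g /=.
  by move=> cf cg x; apply: cvgD; [exact: cf|exact: cg].
move=> [df Df] [dg Dg]; split=> [x|w]; first exact: differentiableD.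
rewrite [X in classC p X](_ : _ = fun x => 'D_w f x + 'D_w g x).
  exact: IHp.
by apply/funext => x; rewrite -deriveD//; exact: diff_derivable.
Qed.

Lemma classC_sum V W p (I : finType) (f : I -> V -> W) :
  (forall i, classC p (f i)) -> classC p (fun x => \sum_i f i x).
Proof.
move=> Cf; rewrite /index_enum; case: index_enum_key => /=.
elim: (Finite.enum I) => [|i s IHs].
  by under eq_fun do rewrite big_nil; exact: classC_cst.
by under eq_fun do rewrite big_cons; exact: classC_add.
Qed.

(** A linear map out of a matrix space is a finite combination of entries. *)
Lemma linear_mx_continuous m n W
  (f : 'M[R]_(m, n) -> W) : linear f -> continuous f.
Proof.
move=> lf.
pose fM := GRing.isLinear.Build _ _ _ _ f lf.
pose fL : {linear 'M[R]_(m, n) -> W} := HB.pack f fM.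
rewrite [f](_ : _ = fun x : 'M[R]_(m, n) =>
    \sum_i \sum_j x i j *: f (delta_mx i j)); last first.
  apply/funext => x; rewrite -[f]/(fL : _ -> _) {1}[x]matrix_sum_delta linear_sum.
  by apply: eq_bigr => i _; rewrite linear_sum; apply: eq_bigr => j _; rewrite linearZ.
apply: (classC_sum (p := 0)) => i; apply: (classC_sum (p := 0)) => j x.
apply: (@continuous_comp _ _ _ (fun x : 'M[R]_(m, n) => x i j)
  (fun c => c *: f (delta_mx i j))).
  exact: coord_continuous.
exact: scalel_continuous.
Qed.

Lemma classC_mul V p (f g : V -> R) :
  classC p f -> classC p g -> classC p (fun x => f x * g x).
Proof.
elim: p f g => [|p IHp] f g.
  by move=> cf cg x; exact: (continuousM (cf x) (cg x)).
move=> Cf Cg; have [df Df] := Cf; have [dg Dg] := Cg.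
split=> [x|w]; first exact: differentiableM.
rewrite [X in classC p X](_ : _ = fun x => f x * 'D_w g x + g x * 'D_w f x).
  apply: classC_add.
    by apply: IHp; [exact: classC_pred Cf|exact: Dg].
  by apply: IHp; [exact: classC_pred Cg|exact: Df].
apply/funext => x.
by apply: (@deriveM _ _ f g); exact: diff_derivable.
Qed.

Lemma classC_pair U V W p (f : U -> V) (g : U -> W) :
  classC p f -> classC p g -> classC p (fun x => (f x, g x)).
Proof.
elim: p f g => [|p IHp] f g /=.
  by move=> cf cg x; apply: cvg_pair; [exact: cf|exact: cg].
move=> [df Df] [dg Dg]; split=> [x|w]; first exact: differentiable_pair.
rewrite [X in classC p X](_ : _ = fun x => ('D_w f x, 'D_w g x)); first exact: IHp.
apply/funext => x; rewrite !deriveE//; last exact: differentiable_pair.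
by rewrite diff_pair.
Qed.

Lemma classC_mx V p m n (f : V -> 'M[R]_(m, n)) :
  (forall i j, classC p (fun x => f x i j)) -> classC p f.
Proof.
move=> Cf.
rewrite [f](_ : _ = fun x => \sum_i \sum_j f x i j *: delta_mx i j); last first.
  by apply/funext => x; exact: matrix_sum_delta.
apply: classC_sum => i; apply: classC_sum => j.
have lin : linear (fun c : R => c *: (delta_mx i j : 'M[R]_(m, n))).
  by move=> a c d; rewrite scalerDl scalerA.
by apply: (classC_comp_linear lin) => //; exact: scalel_continuous.
Qed.

Lemma classC_coord V p m n (f : V -> 'M[R]_(m, n)) i j :
  classC p f -> classC p (fun x => f x i j).
Proof.
apply: (@classC_comp_linear _ _ _ _ (fun x : 'M[R]_(m, n) => x i j)).
  exact: linear_coord.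
exact: coord_continuous.
Qed.

Lemma classC_mulmx V p m n q (f : V -> 'M[R]_(m, n)) (g : V -> 'M[R]_(n, q)) :
  classC p f -> classC p g -> classC p (fun x => f x *m g x).
Proof.
move=> Cf Cg; apply: classC_mx => i j; under eq_fun do rewrite mxE.
by apply: classC_sum => l; apply: classC_mul; exact: classC_coord.
Qed.

Lemma classC_opp V W p (f : V -> W) : classC p f -> classC p (fun x => - f x).
Proof.
apply: (@classC_comp_linear _ _ _ _ -%R); last exact: opp_continuous.
by move=> a x y; rewrite opprD scalerN.
Qed.

(** Finite dimensionality with continuous coordinates, in a form that is
stable under products of normed spaces. *)
Definition finite_basis V : Prop :=
  exists (I : finType) (e : I -> V) (c : I -> V -> R),
    (forall i, linear (c i) /\ continuous (c i)) /\
    forall x, x = \sum_i c i x *: e i.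

Lemma finite_basis_mx m n : finite_basis 'M[R]_(m, n).
Proof.
exists ('I_m * 'I_n)%type, (fun ij => delta_mx ij.1 ij.2),
  (fun ij (x : 'M[R]_(m, n)) => x ij.1 ij.2); split=> [ij|x].
  by split; [exact: linear_coord|exact: coord_continuous].
by rewrite {1}[x]matrix_sum_delta pair_bigA.
Qed.

Lemma finite_basis_prod V W :
  finite_basis V -> finite_basis W -> finite_basis (V * W)%type.
Proof.
move=> [I [e [c [lc cE]]]] [J [e' [c' [lc' cE']]]].
exists (I + J)%type, (fun k => match k with inl i => (e i, 0) | inr j => (0, e' j) end),
  (fun k (x : V * W) => match k with inl i => c i x.1 | inr j => c' j x.2 end).
split=> [[i|j]|x].
- have [l k] := lc i; split=> [a x y|x]; first exact: l.
  by apply: continuous_comp; [exact: cvg_fst|exact: k].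
- have [l k] := lc' j; split=> [a x y|x]; first exact: l.
  by apply: continuous_comp; [exact: cvg_snd|exact: k].
case: x => x y; rewrite big_sumType/=.
have -> : \sum_i c i x *: (e i, 0 : W) = (x, 0 : W).
  rewrite {2}[x]cE; elim/big_rec2: _ => // i u _ _ ->.
  by apply/eqP; rewrite xpair_eqE /= scaler0 addr0 !eqxx.
have -> : \sum_j c' j y *: (0 : V, e' j) = (0 : V, y).
  rewrite {2}[y]cE'; elim/big_rec2: _ => // j u _ _ ->.
  by apply/eqP; rewrite xpair_eqE /= scaler0 addr0 !eqxx.
by apply/eqP; rewrite xpair_eqE /= addr0 add0r !eqxx.
Qed.

(** The derivative of [g \o f] in the direction [w] is the differential of [g]
at [f x] evaluated at ['D_w f x]; expanding this vector in a finite basis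
leaves sums of products of C^p functions. *)
Lemma classC_comp U V p (g : V -> R) (f : U -> V) : finite_basis V ->
  classC p g -> classC p f -> classC p (fun x => g (f x)).
Proof.
move=> [I [e [c [lc cE]]]]; elim: p g f => [|p IHp] g f.
  by move=> cg cf x; apply: continuous_comp; [exact: cf|exact: cg].
move=> [dg Dg] Cf; have [df Df] := Cf.
split=> [x|w]; first exact: differentiable_comp.
rewrite [X in classC p X](_ : _ =
    fun x => \sum_i c i ('D_w f x) * 'D_(e i) g (f x)).
  apply: classC_sum => i; apply: classC_mul.
    by have [li ki] := lc i; exact: (classC_comp_linear li ki (Df w)).
  exact: (IHp _ _ (Dg (e i)) (classC_pred Cf)).
apply/funext => x; rewrite deriveE; last exact: differentiable_comp.
rewrite diff_comp//= -(deriveE w (df x)) {1}['D_w f x]cE linear_sum.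
by apply: eq_bigr => i _; rewrite linearZ/= (deriveE (e i) (dg (f x))).
Qed.

End Smooth.

(** * Differentiable paths, linear equations and boundedness *)

Section Paths.
Variable R : realType.
Implicit Types V W : normedModType R.

(** Bundles [ode_path] with its derivative (see [path_derivP]), so that sums
and linear images of paths come with their equations. *)
Definition path_deriv V (x dx : R -> V) : Prop :=
  {within `[0, +oo[, continuous x} /\
  forall t : R, 0 < t -> is_derive t (1 : R) x (dx t).

Lemma path_derivP V (x dx : R -> V) :
  path_deriv x dx <->
  ode_path x /\ forall t : R, 0 < t -> x^`()%classic t = dx t.
Proof.
split=> [[cx Dx]|[[cx Dx] xE]].
  split; first by split=> // t t0; have [] := Dx t t0.
  by move=> t t0; rewrite derive1E; have [] := Dx t t0.
split=> // t t0; rewrite -xE// derive1E.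
by split=> //; exact: Dx.
Qed.

Lemma path_deriv_ext V (x dx dx' : R -> V) :
  (forall t : R, 0 < t -> dx t = dx' t) -> path_deriv x dx -> path_deriv x dx'.
Proof. by move=> dE [cx Dx]; split=> // t t0; rewrite -dE//; exact: Dx. Qed.

Lemma is_derive_linear V W (f : V -> W) (x : R -> V) t dx :
  linear f -> continuous f -> is_derive t (1 : R) x dx ->
  is_derive t (1 : R) (fun s => f (x s)) (f dx).
Proof.
move=> lf cf [/derivable1_diffP dx_t xE].
have [df dfE] := linear_diff (x t) lf cf.
split; first by apply/derivable1_diffP; exact: differentiable_comp.
rewrite deriveE; last exact: differentiable_comp.
by rewrite diff_comp//= dfE -deriveE// xE.
Qed.

Lemma is_derive_coord m n (x : R -> 'M[R]_(m, n)) t (dx : 'M[R]_(m, n)) i j :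
  is_derive t (1 : R) x dx -> is_derive t (1 : R) (fun s => x s i j) (dx i j).
Proof.
apply: (@is_derive_linear _ _ (fun A : 'M[R]_(m, n) => A i j)).
  exact: linear_coord.
exact: coord_continuous.
Qed.

Lemma is_derive_mx m n (x : R -> 'M[R]_(m, n)) t (dx : 'M[R]_(m, n)) :
  (forall i j, is_derive t (1 : R) (fun s => x s i j) (dx i j)) ->
  is_derive t (1 : R) x dx.
Proof.
move=> Dx; have x1 : derivable x t 1.
  by apply/derivable_mxP => i j; have [] := Dx i j.
split=> //; rewrite derive_mx//; apply/matrixP => i j; rewrite mxE.
by have [] := Dx i j.
Qed.

Lemma path_deriv_linear V W (f : V -> W) (x dx : R -> V) :
  linear f -> continuous f -> path_deriv x dx ->
  path_deriv (fun t => f (x t)) (fun t => f (dx t)).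
Proof.
move=> lf cf [cx Dx]; split=> [t|t t0].
  by apply: continuous_comp; [exact: cx|exact: cf].
by apply: is_derive_linear => //; exact: Dx.
Qed.

Lemma path_deriv_linear_mx m n W (f : 'M[R]_(m, n) -> W) x dx :
  linear f -> path_deriv x dx ->
  path_deriv (fun t => f (x t)) (fun t => f (dx t)).
Proof. by move=> lf; apply: path_deriv_linear => //; exact: linear_mx_continuous. Qed.

Lemma path_deriv_mulmx m n p (A : 'M[R]_(m, n)) (x dx : R -> 'M[R]_(n, p)) :
  path_deriv x dx -> path_deriv (fun t => A *m x t) (fun t => A *m dx t).
Proof. by apply: path_deriv_linear_mx => a u v; rewrite mulmxDr scalemxAr. Qed.

Lemma path_derivD V (x dx y dy : R -> V) :
  path_deriv x dx -> path_deriv y dy ->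
  path_deriv (fun t => x t + y t) (fun t => dx t + dy t).
Proof.
move=> [cx Dx] [cy Dy]; split; first exact: within_continuousD.
by move=> t t0; have Dxt := Dx t t0; have Dyt := Dy t t0; exact: is_deriveD.
Qed.

Lemma path_derivN V (x dx : R -> V) :
  path_deriv x dx -> path_deriv (fun t => - x t) (fun t => - dx t).
Proof.
apply: path_deriv_linear; last exact: opp_continuous.
by move=> a u v; rewrite opprD scalerN.
Qed.

Lemma path_derivB V (x dx y dy : R -> V) :
  path_deriv x dx -> path_deriv y dy ->
  path_deriv (fun t => x t - y t) (fun t => dx t - dy t).
Proof. by move=> px /path_derivN; exact: path_derivD. Qed.

Lemma col_mx_sum m1 m2 n (A : 'M[R]_(m1, n)) (B : 'M[R]_(m2, n)) :
  col_mx A B = col_mx A 0 + col_mx 0 B.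
Proof. by rewrite add_col_mx addr0 add0r. Qed.

Lemma linear_col_mx0 m1 m2 n :
  linear (fun A : 'M[R]_(m1, n) => col_mx A (0 : 'M[R]_(m2, n))).
Proof. by move=> a A B; rewrite scale_col_mx add_col_mx scaler0 addr0. Qed.

Lemma linear_col_0mx m1 m2 n :
  linear (fun B : 'M[R]_(m2, n) => col_mx (0 : 'M[R]_(m1, n)) B).
Proof. by move=> a A B; rewrite scale_col_mx add_col_mx scaler0 addr0. Qed.

Lemma path_deriv_col_mx m1 m2 n (x dx : R -> 'M[R]_(m1, n))
    (y dy : R -> 'M[R]_(m2, n)) : path_deriv x dx -> path_deriv y dy ->
  path_deriv (fun t => col_mx (x t) (y t)) (fun t => col_mx (dx t) (dy t)).
Proof.
move=> Dx Dy; under eq_fun do rewrite col_mx_sum.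
under [X in path_deriv _ X]eq_fun do rewrite col_mx_sum.
apply: path_derivD; first exact: path_deriv_linear_mx (@linear_col_mx0 _ _ _) Dx.
exact: path_deriv_linear_mx (@linear_col_0mx _ _ _) Dy.
Qed.

Lemma path_derivM (x dx y dy : R -> R) :
  path_deriv x dx -> path_deriv y dy ->
  path_deriv (fun t => x t * y t) (fun t => x t * dy t + y t * dx t).
Proof.
move=> [cx Dx] [cy Dy]; split=> [t|t t0].
  exact: (continuousM (cx t) (cy t)).
by have Dxt := Dx t t0; have Dyt := Dy t t0; exact: is_deriveM.
Qed.

Lemma path_deriv_cst V (c : V) : path_deriv (fun=> c) (fun=> 0).
Proof.
split=> [|t _]; last exact: is_derive_cst.
by apply: continuous_subspaceT => x; exact: cst_continuous.
Qed.

Lemma path_deriv_sum V (I : Type) (s : seq I) (x dx : I -> R -> V) :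
  (forall i, path_deriv (x i) (dx i)) ->
  path_deriv (fun t => \sum_(i <- s) x i t) (fun t => \sum_(i <- s) dx i t).
Proof.
move=> px; elim: s => [|i s IHs].
  under eq_fun do rewrite big_nil; under [X in path_deriv _ X]eq_fun do rewrite big_nil.
  exact: path_deriv_cst.
under eq_fun do rewrite big_cons; under [X in path_deriv _ X]eq_fun do rewrite big_cons.
exact: path_derivD.
Qed.

Lemma path_deriv_nonincreasing (f df : R -> R) t : path_deriv f df ->
  (forall s : R, 0 < s -> df s <= 0) -> 0 <= t -> f t <= f 0.
Proof.
move=> [cf Df] df_le0 t0.
apply: (@ler0_derive1_nincry _ _ 0) => // x; rewrite in_itv/= andbT => x0.
  by have [] := Df x x0.
by rewrite derive1E; have [_ ->] := Df x x0; exact: df_le0.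
Qed.

Lemma is_derive_affine (a b t : R) : is_derive t (1 : R) (fun s => a * s + b) a.
Proof.
have H : is_derive t (1 : R) (a \*: (id : R -> R) + cst b) (a *: 1 + 0).
  by apply: is_deriveD.
by apply: (is_derive_eq H); rewrite addr0 [LHS]mulr1.
Qed.

(** Gronwall: |e|^2 has derivative at most 2 c |e|^2 with c the sum of the
moduli of the entries of A, so exp(-2 c t) |e|^2 is nonincreasing from 0. *)
Lemma linear_ode_unique n (A : 'M[R]_n) (e : R -> 'cV[R]_n) :
  path_deriv e (fun t => A *m e t) -> e 0 = 0 -> forall t : R, 0 <= t -> e t = 0.
Proof.
move=> De e0 t t0.
pose c : R := \sum_i \sum_j `|A i j|.
pose f s := \sum_i e s i 0 * e s i 0.
pose df s := \sum_i (e s i 0 * (A *m e s) i 0 + e s i 0 * (A *m e s) i 0).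
have Df : path_deriv f df.
  apply: path_deriv_sum => i; apply: path_derivM;
  by apply: (path_deriv_linear_mx (f := fun x : 'cV[R]_n => x i 0));
    first exact: linear_coord.
have sqf s i : e s i 0 * e s i 0 <= f s.
  rewrite /f (bigD1 i)//= lerDl sumr_ge0// => j _.
  by rewrite -expr2 sqr_ge0.
have df_le s : df s <= 2 * c * f s.
  have -> : df s = 2 * \sum_i \sum_j A i j * (e s i 0 * e s j 0).
    rewrite mulr_sumr; apply: eq_bigr => i _.
    rewrite !mxE mulr_sumr -mulr2n mulr_natl; congr (_ *+ _).
    by apply: eq_bigr => j _; ring.
  rewrite -mulrA ler_wpM2l// mulr_suml; apply: ler_sum => i _.
  rewrite mulr_suml; apply: ler_sum => j _.
  apply: le_trans (ler_norm _) _; rewrite normrM ler_wpM2l//.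
  (* 2 |e_i e_j| <= e_i^2 + e_j^2 <= 2 f s *)
  have := sqf s i; have := sqf s j.
  have := sqr_ge0 (e s i 0 - e s j 0); have := sqr_ge0 (e s i 0 + e s j 0).
  by rewrite ler_norml !expr2 => *; apply/andP; split; lra.
(* The summand 0 makes the exponent an instance of [is_derive_affine]. *)
pose g s := expR (- (2 * c) * s + 0).
have gE s : is_derive s (1 : R) g (- (2 * c) * g s).
  rewrite mulrC; apply: (@is_derive1_comp _ expR (fun s => - (2 * c) * s + 0)).
  exact: is_derive_affine.
have Dg : path_deriv g (fun s => - (2 * c) * g s).
  split=> [|s _]; last exact: gE.
  apply: continuous_subspaceT => s; apply: differentiable_continuous.
  by apply/derivable1_diffP; have [] := gE s.
have f_le : g t * f t <= g 0 * f 0.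
  apply: (path_deriv_nonincreasing (path_derivM Dg Df)) => // s s0.
  have -> : g s * df s + f s * (- (2 * c) * g s) = g s * (df s - 2 * c * f s).
    by ring.
  by rewrite mulr_ge0_le0 ?expR_ge0// subr_le0.
have f0 : f 0 = 0 by rewrite /f big1// => i _; rewrite e0 mxE mul0r.
move: f_le; rewrite f0 mulr0 pmulr_rle0 ?expR_gt0// => ft.
apply/matrixP => i j; rewrite ord1 mxE.
have /le_trans/(_ ft) := sqf t i.
by rewrite -expr2 => eti; apply/eqP; rewrite -sqrf_eq0 eq_le eti sqr_ge0.
Qed.

Lemma bounded_pathP V (x : R -> V) :
  bounded_path x <-> exists M, forall t : R, 0 <= t -> `|x t| <= M.
Proof.
have PF : ProperFilter (globally `[(0 : R), +oo[%classic).
  by apply: (@globally_properfilter _ _ (0 : R)); rewrite /= in_itv/= lexx.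
rewrite /bounded_path ex_bound; split=> -[M xM]; exists M => t.
  by move=> t0; apply: xM; rewrite /= in_itv/= andbT.
by rewrite /= in_itv/= andbT; exact: xM.
Qed.

Lemma bounded_path_linear m n W (f : 'M[R]_(m, n) -> W) x :
  linear f -> bounded_path x -> bounded_path (fun t => f (x t)).
Proof.
move=> lf /bounded_pathP[M xM].
pose fM := GRing.isLinear.Build _ _ _ _ f lf.
pose fL : {linear 'M[R]_(m, n) -> W} := HB.pack f fM.
have [k k0 fk] := @linear_lipschitz _ _ _ fL (linear_mx_continuous lf).
apply/bounded_pathP; exists (k * M) => t t0.
by apply: le_trans (fk (x t)) _; apply: ler_wpM2l; [exact: ltW|exact: xM].
Qed.

Lemma bounded_pathD V (x y : R -> V) :
  bounded_path x -> bounded_path y -> bounded_path (fun t => x t + y t).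
Proof.
move=> /bounded_pathP[M xM] /bounded_pathP[M' yM]; apply/bounded_pathP.
exists (M + M') => t t0; apply: le_trans (ler_normD _ _) _.
by apply: lerD; [exact: xM|exact: yM].
Qed.

Lemma bounded_path_col_mx m1 m2 n (x : R -> 'M[R]_(m1, n)) (y : R -> 'M[R]_(m2, n)) :
  bounded_path x -> bounded_path y -> bounded_path (fun t => col_mx (x t) (y t)).
Proof.
move=> bx b_y; under eq_fun do rewrite col_mx_sum.
apply: bounded_pathD; first exact: bounded_path_linear (@linear_col_mx0 _ _ _) bx.
exact: bounded_path_linear (@linear_col_0mx _ _ _) b_y.
Qed.

End Paths.

(** * Derivatives of a multi-tone disturbance *)

Section Disturbance.
Variables (R : realType) (m : 'I_3 -> nat).
Implicit Type d : disturbance R m.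

(** The disturbance whose signal is the time derivative of that of [d]: a cosine
is a sine with phase advanced by pi / 2.  Hence all derivatives of a multi-tone
signal are multi-tone signals. *)
Definition dist_shift d : disturbance R m :=
  Disturbance (fun=> 0) (fun i j => ampl d j * freq d j)
    (fun i (j : 'I_(m i)) => freq d j) (fun i (j : 'I_(m i)) => phase d j + pi / 2).

Lemma is_derive_dist_coord d i t :
  is_derive t (1 : R) (dist_coord d i) (dist_coord (dist_shift d) i t).
Proof.
rewrite /dist_coord /= add0r -[X in is_derive _ _ _ X]add0r.
apply: is_deriveD.
rewrite [X in is_derive _ _ X _](_ : _ =
    \sum_(j < m i) (fun s => ampl d j * sin (freq d j * s + phase d j))); last first.
  by apply/funext => s; rewrite fct_sumE.
apply: is_derive_sum => j; rewrite addrA sinDpihalf -mulrA.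
apply: is_deriveZ; rewrite [X in is_derive _ _ _ X]mulrC.
apply: (@is_derive1_comp _ sin (fun s => freq d j * s + phase d j)).
exact: is_derive_affine.
Qed.

Lemma derive1n_dist_coord d i k :
  derive1n k (dist_coord d i) = dist_coord (iter k dist_shift d) i.
Proof.
elim: k => [//|k IHk]; rewrite derive1nS IHk; apply/funext => t.
by rewrite derive1E; have [] := is_derive_dist_coord (iter k dist_shift d) i t.
Qed.

Lemma is_derive_derive1n_dist d i k t :
  is_derive t (1 : R) (derive1n k (dist_coord d i))
    (derive1n k.+1 (dist_coord d i) t).
Proof. by rewrite !derive1n_dist_coord; exact: is_derive_dist_coord. Qed.

End Disturbance.

(** * Quaternion error kinematics *)

Section Quaternions.
Variable R : realType.
Implicit Types (x y v w : 'cV[R]_3) (q qd : 'cV[R]_(3 + 1)) (s : R).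

Lemma quatE q : q = quat (qvec q) (qscal q).
Proof. by rewrite /quat /qscal -mx11_scalar vsubmxK. Qed.

Lemma qvec_quat v s : qvec (quat v s) = v.
Proof. exact: col_mxKu. Qed.

Lemma qscal_quat v s : qscal (quat v s) = s.
Proof. by rewrite /qscal /quat col_mxKd mxE eqxx. Qed.

Lemma cV3P x y : x 0 0 = y 0 0 -> x 1 0 = y 1 0 -> x 2%:R 0 = y 2%:R 0 -> x = y.
Proof.
move=> x0 x1 x2; apply/matrixP => i j; rewrite ord1 => {j}.
case: i => -[|[|[|//]]] lti.
- by move: x0; congr (x _ _ = y _ _); apply/val_inj.
- by move: x1; congr (x _ _ = y _ _); apply/val_inj.
- by move: x2; congr (x _ _ = y _ _); apply/val_inj.
Qed.

Lemma sum3E (F : 'I_3 -> R) : \sum_i F i = F 0 + F 1 + F 2%:R.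
Proof.
rewrite !big_ord_recl big_ord0 addr0 addrA; congr (_ + _ + _);
by congr (F _); apply/val_inj.
Qed.

Lemma cross0E x y : (cross_mx x *m y) 0 0 = x 1 0 * y 2%:R 0 - x 2%:R 0 * y 1 0.
Proof. by rewrite mxE sum3E !mxE/=; ring. Qed.

Lemma cross1E x y : (cross_mx x *m y) 1 0 = x 2%:R 0 * y 0 0 - x 0 0 * y 2%:R 0.
Proof. by rewrite mxE sum3E !mxE/=; ring. Qed.

Lemma cross2E x y : (cross_mx x *m y) 2%:R 0 = x 0 0 * y 1 0 - x 1 0 * y 0 0.
Proof. by rewrite mxE sum3E !mxE/=; ring. Qed.

Definition crossE := (cross0E, cross1E, cross2E).

Lemma dotE x y :
  (x^T *m y) 0 0 = x 0 0 * y 0 0 + x 1 0 * y 1 0 + x 2%:R 0 * y 2%:R 0.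
Proof. by rewrite mxE sum3E !mxE. Qed.

Lemma quat_rateE v s w : quat_rate (quat v s) w =
  quat (2^-1 *: (cross_mx v *m w + s *: w)) (- 2^-1 * (v^T *m w) 0 0).
Proof.
rewrite /quat_rate qvec_quat qscal_quat mul_col_mx scale_col_mx /quat.
rewrite mulmxDl mul_scalar_mx; congr col_mx.
by rewrite [LHS]mx11_scalar mulNmx; congr (_ %:M); rewrite !mxE mulrN mulNr.
Qed.

Lemma linear_quat_err qd : linear (quat_err qd).
Proof.
move=> a p q.
have qvecP : qvec (a *: p + q) = a *: qvec p + qvec q by rewrite /qvec linearP.
have qscalP : qscal (a *: p + q) = a * qscal p + qscal q by rewrite /qscal !mxE.
rewrite /quat_err qvecP qscalP /quat scale_col_mx add_col_mx scale_scalar_mx.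
rewrite -raddfD/=; congr (col_mx _ _%:M).
  by apply: cV3P; rewrite ?(crossE, dotE, mxE); ring.
by rewrite ?(dotE, mxE); ring.
Qed.

(** Left multiplication by a constant quaternion commutes with the right
multiplication by the angular velocity. *)
Lemma quat_err_rate qd q w :
  quat_err qd (quat_rate q w) = quat_rate (quat_err qd q) w.
Proof.
rewrite [q]quatE {1}/quat_err !quat_rateE !qvec_quat !qscal_quat.
congr quat; last by rewrite ?(dotE, crossE, mxE); field.
by apply: cV3P; rewrite ?(crossE, dotE, mxE); ring.
Qed.

Definition quat_conj q : 'cV[R]_(3 + 1) := quat (- qvec q) (qscal q).

(** With [qd] replaced by its conjugate, [quat_err] multiplies by [qd] itself;
the composite scales by the squared norm of [qd]. *)
Lemma quat_err_conjK qd q : unit_quat qd ->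
  quat_err qd (quat_err (quat_conj qd) q) = q.
Proof.
rewrite /unit_quat/= dotE => qd1; rewrite [RHS]quatE [q in LHS]quatE.
rewrite /quat_err !qvec_quat !qscal_quat /quat_conj ?qvec_quat ?qscal_quat.
(* Each component on the left is that of [q] times the squared norm of [qd]. *)
have E (c d : R) : c = (qvec qd 0 0 * qvec qd 0 0 + qvec qd 1 0 * qvec qd 1 0 +
    qvec qd 2%:R 0 * qvec qd 2%:R 0 + qscal qd ^+ 2) * d -> c = d.
  by rewrite qd1 mul1r.
congr quat; first by apply: cV3P; apply: E; rewrite ?(crossE, dotE, mxE); ring.
by apply: E; rewrite ?(crossE, dotE, mxE); ring.
Qed.

Lemma unit_quat_conj q : unit_quat q -> unit_quat (quat_conj q).
Proof.
by rewrite /unit_quat/= qvec_quat qscal_quat !dotE !mxE !mulrNN.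
Qed.

Lemma quat_conjK q : quat_conj (quat_conj q) = q.
Proof. by rewrite /quat_conj qvec_quat qscal_quat opprK -quatE. Qed.

Lemma quat_errK qd q : unit_quat qd ->
  quat_err (quat_conj qd) (quat_err qd q) = q.
Proof.
by move=> /unit_quat_conj qd1; rewrite -{2}[qd]quat_conjK quat_err_conjK.
Qed.

End Quaternions.

Section QuatPaths.
Variables (R : realType) (qd : 'cV[R]_(3 + 1)).

Lemma path_quat_err q w :
  path_deriv q (fun t => quat_rate (q t) (w t)) ->
  path_deriv (fun t => quat_err qd (q t))
    (fun t => quat_rate (quat_err qd (q t)) (w t)).
Proof.
move=> /(path_deriv_linear_mx (linear_quat_err qd)).
by apply: path_deriv_ext => t _; exact: quat_err_rate.
Qed.

End QuatPaths.

(** * Steady state of the internal model *)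

Section InternalModel.
Variables (R : realType) (r : 'I_3 -> nat) (hr : forall i, (0 < r i)%N).
Variables (m : 'I_3 -> nat) (d : disturbance R m).
Variable a : forall i, 'I_(r i) -> R.
Hypothesis da : dist_ode d a.
Variables (M : forall i, 'M[R]_(r i)) (N : forall i, 'cV[R]_(r i)).
Variable T : forall i, 'M[R]_(r i).
Hypothesis Tunit : forall i, T i \in unitmx.
Hypothesis TE : forall i,
  T i *m companion (@a i) - M i *m T i = N i *m first_row R (r i).

(** The companion matrix shifts the vector of derivatives; the last row is the
differential equation of the disturbance. *)
Lemma companion_varrho i t (j : 'I_(r i)) :
  (companion (@a i) *m varrho r d i t) j 0 = derive1n j.+1 (dist_coord d i) t.
Proof.
rewrite mxE; have [jr|jr] := eqVneq j.+1 (r i).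
  by rewrite jr da; apply: eq_bigr => l _; rewrite !mxE jr eqxx.
have jlt : (j.+1 < r i)%N by rewrite ltn_neqAle jr ltn_ord.
rewrite (bigD1 (Ordinal jlt))//= !mxE (negbTE jr) eqxx mul1r big1 ?addr0// => l.
by rewrite -val_eqE/= => lj; rewrite !mxE (negbTE jr) (negbTE lj) mul0r.
Qed.

Lemma first_row_varrho i t :
  first_row R (r i) *m varrho r d i t = (dist_coord d i t)%:M.
Proof.
rewrite [LHS]mx11_scalar; congr (_ %:M); rewrite mxE (bigD1 (Ordinal (hr i)))//=.
rewrite !mxE/= mul1r big1 ?addr0// => l; rewrite -val_eqE/= => l0.
by rewrite !mxE (negbTE l0) mul0r.
Qed.

Lemma blockN_mul (x : 'cV[R]_3) : blockN N *m x = \mxcol_i (x i 0 *: N i).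
Proof.
rewrite /blockN mxcol_mul; apply: eq_mxcol => i.
rewrite -mulmxA -rowE [row i x]mx11_scalar mul_mx_scalar; congr (_ *: _).
by rewrite mxE.
Qed.

(** The Sylvester equation turns - T Phi varrho into - (M T + N Psi) varrho. *)
Lemma path_theta : path_deriv (theta d T)
  (fun t => \mxdiag_i M i *m theta d T t - blockN N *m dist d t).
Proof.
have Dv i t : is_derive t (1 : R) (varrho r d i) (companion (@a i) *m varrho r d i t).
  have Dj j k : is_derive t (1 : R) (fun s => varrho r d i s j k)
      ((companion (@a i) *m varrho r d i t) j k).
    rewrite ord1 companion_varrho; under eq_fun do rewrite mxE.
    exact: is_derive_derive1n_dist.
  exact: is_derive_mx.
have TvE i t : - T i *m (companion (@a i) *m varrho r d i t) =
    M i *m (- T i *m varrho r d i t) - dist_coord d i t *: N i.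
  rewrite -mul_mx_scalar -first_row_varrho [N i *m _]mulmxA -TE mulmxBl.
  by rewrite !mulNmx mulmxN !mulmxA opprB addKr.
have Dth t : is_derive t (1 : R) (theta d T)
    (\mxcol_i (- T i *m (companion (@a i) *m varrho r d i t))).
  have Di i : is_derive t (1 : R) (fun s => - T i *m varrho r d i s)
      (- T i *m (companion (@a i) *m varrho r d i t)).
    have lT : linear (fun x : 'cV[R]_(r i) => - T i *m x).
      by move=> c x y; rewrite mulmxDr scalemxAr.
    exact: is_derive_linear lT (linear_mx_continuous lT) (Dv i t).
  apply: is_derive_mx => j k; under eq_fun do rewrite mxE; rewrite mxE.
  exact: is_derive_coord.
split=> [|t _].
  apply: continuous_subspaceT => t; apply: differentiable_continuous.
  by apply/derivable1_diffP; have [] := Dth t.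
rewrite blockN_mul mul_mxdiag_mxcol -mxcolB.
by apply: is_derive_eq (Dth t) _; apply: eq_mxcol => i; rewrite mxE -TvE.
Qed.

(** As theta = - T varrho, the matrix T^-1 recovers - varrho, whose leading
entries form - d. *)
Lemma PsiTinv_theta t :
  blockPsi R r *m invmx (\mxdiag_i T i) *m theta d T t = - dist d t.
Proof.
have Dunit : \mxdiag_i T i \in unitmx.
  pose X := \mxcol_i (invmx (T i) *m submxcol (1%:M : 'M[R]_(\sum_i r i)) i).
  have /mulmx1_unit[] // : \mxdiag_i T i *m X = 1%:M.
  rewrite mul_mxdiag_mxcol -[RHS]submxcolK; apply: eq_mxcol => i.
  by rewrite mulmxA mulmxV// mul1mx.
have thE : theta d T t = \mxdiag_i T i *m \mxcol_i (- varrho r d i t).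
  by rewrite mul_mxdiag_mxcol; apply: eq_mxcol => i; rewrite mulNmx mulmxN.
rewrite thE -mulmxA mulKmx// /blockPsi mul_mxrow_mxcol.
under eq_bigr do rewrite mulmxN -mulmxA first_row_varrho mul_mx_scalar.
rewrite sumrN; congr (- _); apply/matrixP => i j; rewrite ord1 summxE mxE.
rewrite (bigD1 i)//= !mxE !eqxx mulr1 big1 ?addr0// => l li.
by rewrite !mxE eq_sym (negbTE li) mulr0.
Qed.

End InternalModel.

(** * Smoothness of the control law *)

Section LawSmoothness.
Variable R : realType.
Implicit Types U V W : normedModType R.

Lemma classC_linear_mx U m n W p (g : 'M[R]_(m, n) -> W) (f : U -> 'M[R]_(m, n)) :
  linear g -> classC p f -> classC p (fun x => g (f x)).
Proof. by move=> lg; apply: classC_comp_linear => //; exact: linear_mx_continuous. Qed.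

Lemma classC_fst U V W p (f : U -> (V * W)%type) :
  classC p f -> classC p (fun x => (f x).1).
Proof. by apply: (classC_comp_linear (g := fst)) => // x; exact: cvg_fst. Qed.

Lemma classC_snd U V W p (f : U -> (V * W)%type) :
  classC p f -> classC p (fun x => (f x).2).
Proof. by apply: (classC_comp_linear (g := snd)) => // x; exact: cvg_snd. Qed.

Lemma classC_id U p : classC p (fun x : U => x).
Proof. by apply: classC_linear => // x; exact: cvg_id. Qed.

Lemma classC_scale U p m n (c : U -> R) (f : U -> 'M[R]_(m, n)) :
  classC p c -> classC p f -> classC p (fun x => c x *: f x).
Proof.
move=> Cc Cf; apply: classC_mx => i j; under eq_fun do rewrite mxE.
by apply: classC_mul => //; exact: classC_coord.
Qed.

Lemma classC_col_mx U p m1 m2 n (f : U -> 'M[R]_(m1, n)) (g : U -> 'M[R]_(m2, n)) :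
  classC p f -> classC p g -> classC p (fun x => col_mx (f x) (g x)).
Proof.
move=> Cf Cg; apply: classC_mx => i j; under eq_fun do rewrite mxE.
by case: (fintype.split i) => l; exact: classC_coord.
Qed.

Lemma linear_cross_mx : linear (@cross_mx R).
Proof.
move=> a x y; apply/matrixP => i j; rewrite !mxE.
case: i => -[|[|[|//]]] ?; case: j => -[|[|[|//]]] ? /=; rewrite ?mxE; ring.
Qed.

Lemma classC_quat_err U p (f g : U -> 'cV[R]_(3 + 1)) :
  classC p f -> classC p g -> classC p (fun x => quat_err (f x) (g x)).
Proof.
move=> Cf Cg.
have Cvec (k : U -> 'cV[R]_(3 + 1)) : classC p k -> classC p (fun x => qvec (k x)).
  by apply: classC_linear_mx => a x y; rewrite /qvec linearP.
have Cscal (k : U -> 'cV[R]_(3 + 1)) : classC p k -> classC p (fun x => qscal (k x)).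
  by apply: classC_linear_mx => a x y; rewrite /qscal !mxE.
apply: classC_col_mx.
  apply: classC_add; last first.
    by apply: classC_opp; apply: classC_scale; [exact: Cscal|exact: Cvec].
  apply: classC_add; first by apply: classC_scale; [exact: Cscal|exact: Cvec].
  apply: classC_opp; apply: classC_mulmx; last exact: Cvec.
  by apply: classC_linear_mx; [exact: linear_cross_mx|exact: Cvec].
under eq_fun do rewrite -scalemx1.
apply: classC_scale; last exact: classC_cst.
apply: classC_add; last by apply: classC_mul; exact: Cscal.
apply: classC_coord; apply: classC_mulmx; last exact: Cvec.
by apply: classC_linear_mx; [move=> a x y; rewrite linearP|exact: Cvec].
Qed.

Lemma classC_comp_mx U V p m n (g : V -> 'M[R]_(m, n)) (f : U -> V) :
  finite_basis V -> classC p g -> classC p f -> classC p (fun x => g (f x)).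
Proof.
move=> bV Cg Cf; apply: classC_mx => i j.
by apply: (classC_comp (g := fun y => g y i j)) => //; exact: classC_coord.
Qed.

Variables (nchi : nat) (r : 'I_3 -> nat).
Variable L0 : {linear 'cV[R]_3 -> 'cV[R]_3}.
Variables (M : forall i, 'M[R]_(r i)) (N : forall i, 'cV[R]_(r i)).
Variables (p : nat) (h : reg_arg R nchi -> 'cV[R]_3)
  (k : reg_arg R nchi -> 'cV[R]_nchi).
Hypotheses (hh : classC p h) (hk : classC p k).

Let arg := ctrl_arg R (\sum_i r i + nchi).

Lemma finite_basis_reg_arg : finite_basis (reg_arg R nchi).
Proof.
by do ?apply: finite_basis_prod; exact: finite_basis_mx.
Qed.

Let reg_of (a : arg) : reg_arg R nchi :=
  (dsubmx a.1.1.1.1, quat_err a.1.1.2 a.1.1.1.2, a.1.2).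

Let C_chi : classC p (fun a : arg => a.1.1.1.1).
Proof. by do 4 apply: classC_fst; exact: classC_id. Qed.

Let C_vel : classC p (fun a : arg => a.1.2).
Proof. by apply: classC_snd; apply: classC_fst; exact: classC_id. Qed.

Let C_reg : classC p reg_of.
Proof.
apply: classC_pair; last exact: C_vel.
apply: classC_pair.
  by apply: classC_linear_mx; [move=> a x y; rewrite linearP|exact: C_chi].
apply: classC_quat_err; apply: classC_snd; last do 1 apply: classC_fst.
  by do 2 apply: classC_fst; exact: classC_id.
by do 2 apply: classC_fst; exact: classC_id.
Qed.

Let C_F0 : classC p (fun a : arg => Ffun L0 a.1.2).
Proof.
apply: classC_mulmx; last first.
  by apply: classC_linear_mx; [move=> a x y; rewrite linearP|exact: C_vel].
by apply: classC_opp; apply: classC_linear_mx; [exact: linear_cross_mx|exact: C_vel].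
Qed.

Lemma classC_law_out : classC p (@law_out R nchi r L0 h).
Proof.
rewrite [law_out _ _](_ : _ = fun a : arg => h (reg_of a) - Ffun L0 a.1.2).
  apply: classC_add; last exact: classC_opp.
  by apply: classC_comp_mx => //; exact: finite_basis_reg_arg.
by apply/funext => -[[[[chi q] qdes] w] wd].
Qed.

Lemma classC_law_dyn : classC p (@law_dyn R nchi r L0 M N h k).
Proof.
rewrite [law_dyn _ _ _ _ _](_ : _ = fun a : arg =>
    col_mx (im_rate L0 M N (usubmx a.1.1.1.1) (law_out L0 h a) a.1.2) (k (reg_of a))).
  have Cm l (A : 'M[R]_(_, l)) f : classC p f -> classC p (fun a : arg => A *m f a).
    by apply: classC_linear_mx => a x y; rewrite linearP.
  apply: classC_col_mx; last first.
    by apply: classC_comp_mx => //; exact: finite_basis_reg_arg.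
  apply: classC_add; last first.
    apply: classC_opp; apply: Cm; apply: classC_linear_mx; last exact: C_vel.
    by move=> a x y; rewrite linearP.
  apply: classC_add; last exact: Cm.
  apply: classC_add; last by apply: Cm; exact: classC_law_out.
  apply: Cm; apply: classC_linear_mx; last exact: C_chi.
  by move=> a x y; rewrite linearP.
by apply/funext => -[[[[chi q] qdes] w] wd].
Qed.

End LawSmoothness.

(** * Plant and augmented system *)

Section ClosedLoops.
Variables (R : realType) (n : nat) (P : spacecraft R n) (qd : 'cV[R]_(3 + 1)).
Variables (nmu : nat) (mu : 'cV[R]_nmu) (L0 : {linear 'cV[R]_3 -> 'cV[R]_3})
  (L1 : {linear 'cV[R]_3 -> 'M[R]_(3, nmu)}).
Hypothesis hL : forall x : 'cV[R]_3, inertia P *m x = L1 x *m mu + L0 x.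
Variables (r : 'I_3 -> nat).
Variables (M : forall i, 'M[R]_(r i)) (N : forall i, 'cV[R]_(r i))
  (T : forall i, 'M[R]_(r i)).
Variables (nchi : nat) (h : reg_arg R nchi -> 'cV[R]_3)
  (k : reg_arg R nchi -> 'cV[R]_nchi).
Variables (dt : R -> 'cV[R]_3) (th : R -> 'cV[R]_(\sum_i r i)).

Let J := inertia P.
Let delta := coupling P.
Let MM := \mxdiag_i M i.
Let NN := blockN N.
Let PsiTinv := blockPsi R r *m invmx (\mxdiag_i T i).

Hypothesis th_deriv : path_deriv th (fun t => MM *m th t - NN *m dt t).
Hypothesis th_out : forall t, PsiTinv *m th t = - dt t.

(** The new coordinate of the internal model state, as in the coordinate
transformation; being linear, it also gives the rate of change from rates. *)
Definition vcheck_of (v th' : 'cV[R]_(\sum_i r i)) (zeta : 'cV[R]_n) (w : 'cV[R]_3) :=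
  v - th' - NN *m delta *m zeta - NN *m J *m w.

Lemma gyroscopic_torque (w : 'cV[R]_3) :
  cross_mx w *m (J *m w) = - (Ffun L1 w *m mu + Ffun L0 w).
Proof. by rewrite hL mulmxDr opprD /Ffun !mulNmx !opprK mulmxA. Qed.

(** Moves the gyroscopic torque to the right, where it splits into its known
part, cancelled by the control, and its part linear in [mu]. *)
Lemma torque_balance (w dw ut d1 z : 'cV[R]_3) :
  J *m dw + cross_mx w *m (J *m w) + z = (ut - Ffun L0 w) + d1 <->
  J *m dw = Ffun L1 w *m mu + ut + d1 - z.
Proof.
rewrite gyroscopic_torque; set a := J *m dw; set f1 := Ffun L1 w *m mu.
split=> [H|->]; last first.
  by apply/matrixP => i j; rewrite !mxE; ring.
have -> : a = (a - (f1 + Ffun L0 w) + z) + (f1 + Ffun L0 w) - z.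
  by rewrite addrAC addrK subrK.
by rewrite H; apply/matrixP => i j; rewrite !mxE; ring.
Qed.

(** The augmented system replaces the disturbance by an expression which is
exact up to the deviation of [vc] from its intended value. *)
Lemma estimated_disturbance t v zeta w vc :
  PsiTinv *m (vc + NN *m delta *m zeta + NN *m J *m w) - PsiTinv *m v =
  dt t + PsiTinv *m (vc - vcheck_of v (th t) zeta w).
Proof.
have -> : dt t = - (PsiTinv *m th t) by rewrite th_out opprK.
rewrite -mulmxBr -mulmxN -mulmxDr; congr (_ *m _).
rewrite /vcheck_of; set x := NN *m delta *m zeta; set y := NN *m J *m w.
by apply/matrixP => i j; rewrite !mxE; ring.
Qed.

(** Here [d0] is the actual disturbance, which drives theta, and [d1] the torque
present in the equation of motion.  They agree for the plant; in the augmented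
system they differ by a linear image of the deviation of vcheck. *)
Lemma vcheck_rate v th' zeta w ut d0 d1 dw dzeta :
  J *m dw = Ffun L1 w *m mu + ut + d1 - delta *m dzeta ->
  vcheck_of (im_rate L0 M N v (ut - Ffun L0 w) w) (MM *m th' - NN *m d0) dzeta dw
  = MM *m vcheck_of v th' zeta w + MM *m NN *m delta *m zeta
    + (MM *m NN *m L1 w - NN *m Ffun L1 w) *m mu + NN *m (d0 - d1).
Proof.
move=> Jdw; rewrite /vcheck_of /im_rate -/MM -/NN -(mulmxA NN J dw) Jdw.
have -> : MM *m (v - th' - NN *m delta *m zeta - NN *m J *m w) =
    MM *m v - MM *m th' - MM *m NN *m delta *m zeta
    - (MM *m NN *m L1 w *m mu + MM *m NN *m L0 w).
  rewrite !mulmxBr -!mulmxA; congr (_ - _).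
  by rewrite -!mulmxDr hL.
rewrite mulmxBl !mulmxBr !mulmxDr !mulmxA.
set x1 := MM *m v; set x2 := NN *m ut; set x3 := NN *m Ffun L0 w.
set x4 := MM *m NN *m L0 w; set x5 := MM *m th'; set x6 := NN *m d0.
set x7 := NN *m delta *m dzeta; set x8 := NN *m d1.
set x9 := MM *m NN *m delta *m zeta; set x10 := MM *m NN *m L1 w *m mu.
set x11 := NN *m Ffun L1 w *m mu.
by apply/matrixP => i j; rewrite !mxE; ring.
Qed.


Lemma path_vcheck v dv zeta dzeta w dw :
  path_deriv v dv -> path_deriv zeta dzeta -> path_deriv w dw ->
  path_deriv (fun t => vcheck_of (v t) (th t) (zeta t) (w t))
    (fun t => vcheck_of (dv t) (MM *m th t - NN *m dt t) (dzeta t) (dw t)).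
Proof.
move=> Dv Dz Dw; apply: path_derivB; last exact: path_deriv_mulmx.
apply: path_derivB; last exact: path_deriv_mulmx.
exact: path_derivB.
Qed.

Let law := law_out L0 h (r := r).
Let dyn := law_dyn L0 M N h k.

Definition augment (x : plant_path R n) (chi : R -> 'cV[R]_(\sum_i r i + nchi)) :
    aug_path R n nchi r :=
  AugPath (fun t => quat_err qd (att x t)) (vel x) (mode x) (mode_rate x)
    (fun t => vcheck_of (usubmx (chi t)) (th t) (mode_rate x t) (vel x t))
    (fun t => usubmx (chi t)) (fun t => dsubmx (chi t)).

Lemma augment_closed_loop x chi : closed_loop P dt qd law dyn x chi ->
  aug_closed_loop P mu L0 L1 M N h k T (augment x chi).
Proof.
case: x => q w eta zeta [[oq ow oeta ozeta ochi] eqs].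
have Dq : path_deriv q (fun t => quat_rate (q t) (w t)).
  by apply/path_derivP; split=> // t /eqs[].
have Dw : path_deriv w w^`()%classic by apply/path_derivP.
have Dz : path_deriv zeta zeta^`()%classic by apply/path_derivP.
have Dchi : path_deriv chi (fun t => dyn (chi t, q t, qd, w t, 0)).
  by apply/path_derivP; split=> // t /eqs[].
pose ut t := h (dsubmx (chi t), quat_err qd (q t), w t).
have Dv : path_deriv (fun t => usubmx (chi t))
    (fun t => im_rate L0 M N (usubmx (chi t)) (ut t - Ffun L0 (w t)) (w t)).
  have lin : linear (@usubmx R (\sum_i r i) nchi 1) by move=> a u v; rewrite linearP.
  apply: path_deriv_ext (path_deriv_linear_mx lin Dchi) => t _.
  by rewrite /dyn /law_dyn col_mxKu.
have Dc : path_deriv (fun t => dsubmx (chi t))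
    (fun t => k (dsubmx (chi t), quat_err qd (q t), w t)).
  have lin : linear (@dsubmx R (\sum_i r i) nchi 1) by move=> a u v; rewrite linearP.
  apply: path_deriv_ext (path_deriv_linear_mx lin Dchi) => t _.
  by rewrite /dyn /law_dyn col_mxKd.
have [oqe qeE] := (path_derivP _ _).1 (path_quat_err qd Dq).
have [ov vE] := (path_derivP _ _).1 Dv.
have [oc cE] := (path_derivP _ _).1 Dc.
have [ovc vcE] := (path_derivP _ _).1 (path_vcheck Dv Dz Dw).
have Jdw (t : R) : 0 < t -> J *m w^`()%classic t =
    Ffun L1 (w t) *m mu + ut t + dt t - delta *m zeta^`()%classic t.
  by move=> t0; apply/torque_balance; have [_ -> _ _ _] := eqs t t0.
split; first exact: And4 oqe ow oeta ozeta.
split; first exact: And3 ovc ov oc.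
move=> t t0; have [_ _ etaE zetaE _] := eqs t t0; split=> /=.
- rewrite -[_ + _ - PsiTinv *m _]addrA (estimated_disturbance t).
  by rewrite subrr mulmx0 addr0; exact: Jdw.
- rewrite vcE// (@vcheck_rate _ _ (zeta t) _ _ _ _ _ _ (Jdw t t0)).
  by rewrite subrr mulmx0 addr0.
- split; first exact: etaE.
  move: zetaE; rewrite !mulNmx => <-.
  by rewrite [RHS]addrC addrA addrAC !addrK.
- exact: qeE.
- by split; [exact: vE|exact: cE].
Qed.

Definition plant_of (y : aug_path R n nchi r) : plant_path R n :=
  PlantPath (fun t => quat_err (quat_conj qd) (aug_err y t)) (aug_vel y)
    (aug_mode y) (aug_mode_rate y).

Definition state_of (y : aug_path R n nchi r) (t : R) :=
  col_mx (aug_v y t) (aug_chi y t).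

Lemma plant_of_closed_loop y : unit_quat qd ->
  aug_closed_loop P mu L0 L1 M N h k T y ->
  aug_vcheck y 0 =
    vcheck_of (aug_v y 0) (th 0) (aug_mode_rate y 0) (aug_vel y 0) ->
  closed_loop P dt qd law dyn (plant_of y) (state_of y).
Proof.
move=> qd1.
case: y => qe w eta zeta vc v chi [[oqe ow oeta ozeta] [[ovc ov ochi] eqs]] /= vc0.
have Dqe : path_deriv qe (fun t => quat_rate (qe t) (w t)).
  by apply/path_derivP; split=> // t /eqs[].
have Dw : path_deriv w w^`()%classic by apply/path_derivP.
have Dz : path_deriv zeta zeta^`()%classic by apply/path_derivP.
pose ut t := h (chi t, qe t, w t).
have Dv : path_deriv v (fun t => im_rate L0 M N (v t) (ut t - Ffun L0 (w t)) (w t)).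
  by apply/path_derivP; split=> // t /eqs[_ _ _ _ []].
have Dchi : path_deriv chi (fun t => k (chi t, qe t, w t)).
  by apply/path_derivP; split=> // t /eqs[_ _ _ _ []].
(* The deviation of vcheck from its value in the transformed plant. *)
pose e t := vc t - vcheck_of (v t) (th t) (zeta t) (w t).
have Jdw (t : R) : 0 < t -> J *m w^`()%classic t = Ffun L1 (w t) *m mu + ut t
    + (dt t + PsiTinv *m e t) - delta *m zeta^`()%classic t.
  move=> t0; have [-> _ _ _ _] := eqs t t0.
  by rewrite -[_ + _ - PsiTinv *m _]addrA (estimated_disturbance t).
have De : path_deriv e (fun t => (MM + NN *m PsiTinv) *m e t).
  have Dvc : path_deriv vc vc^`()%classic by apply/path_derivP.
  apply: path_deriv_ext (path_derivB Dvc (path_vcheck Dv Dz Dw)) => t t0.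
  have [_ -> _ _ _] := eqs t t0.
  rewrite (@vcheck_rate _ _ (zeta t) _ _ _ _ _ _ (Jdw t t0)).
  have -> : (MM + NN *m PsiTinv) *m e t = MM *m vc t
      - MM *m vcheck_of (v t) (th t) (zeta t) (w t) + NN *m (PsiTinv *m e t).
    by rewrite mulmxDl -[in RHS]mulmxBr mulmxA.
  have -> : dt t - (dt t + PsiTinv *m e t) = - (PsiTinv *m e t).
    by rewrite opprD addrA subrr sub0r.
  rewrite mulmxN.
  set x := MM *m vc t; set y := MM *m vcheck_of _ _ _ _.
  set a := (_ *m zeta t); set b := (_ *m mu); set c := NN *m _.
  by apply/matrixP => i j; rewrite !mxE; ring.
have e0 : forall t : R, 0 <= t -> e t = 0.
  by apply: linear_ode_unique De _; rewrite /e vc0 subrr.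
have [oq qE] := (path_derivP _ _).1 (path_quat_err (quat_conj qd) Dqe).
have [os sE] : ode_path (fun t => col_mx (v t) (chi t)) /\ forall t : R, 0 < t ->
    (fun t => col_mx (v t) (chi t))^`()%classic t =
    dyn (col_mx (v t) (chi t), quat_err (quat_conj qd) (qe t), qd, w t, 0).
  apply/path_derivP; apply: path_deriv_ext (path_deriv_col_mx Dv Dchi) => t _.
  by rewrite /dyn /law_dyn /law_out !col_mxKu !col_mxKd quat_err_conjK.
split; first exact: And5 oq ow oeta ozeta os.
move=> t t0; have [_ _ [etaE zetaE] _ _] := eqs t t0; split=> /=.
- exact: qE.
- rewrite /law /law_out col_mxKd quat_err_conjK//.
  by apply/torque_balance; rewrite Jdw// e0 ?ltW// mulmx0 addr0.
- exact: etaE.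
- by rewrite zetaE !mulNmx -opprD -addrA addrAC addNr add0r.
- exact: sE.
Qed.

End ClosedLoops.

(** * Attitude tracking *)

Theorem mainTheorem1 (R : realType) (n : nat) (P : spacecraft R n)
  (* constant desired attitude *)
  (qd : 'cV[R]_(3 + 1)) (hqd : unit_quat qd)
  (* disturbances, with sigma = freq d *)
  (m : 'I_3 -> nat) (D : set (disturbance R m))
  (* parameterization of J *)
  (nmu : nat) (hnmu : (nmu <= 6)%N) (mu : 'cV[R]_nmu)
  (L0 : {linear 'cV[R]_3 -> 'cV[R]_3})
  (L1 : {linear 'cV[R]_3 -> 'M[R]_(3, nmu)})
  (hL : forall x : 'cV[R]_3, inertia P *m x = L1 x *m mu + L0 x)
  (* internal model data *)
  (r : 'I_3 -> nat) (hr : forall i, (0 < r i)%N)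
  (a : freqs R m -> forall i, 'I_(r i) -> R)
  (ha_ode : forall d, D d -> dist_ode d (a (@freq R m d)))
  (ha_roots : forall d, D d -> forall i,
     simple_imaginary_roots (char_pol (a (@freq R m d) i)))
  (M : forall i, 'M[R]_(r i)) (hM : forall i, hurwitz (M i))
  (N : forall i, 'cV[R]_(r i)) (hMN : forall i, controllable (M i) (N i))
  (T : freqs R m -> forall i, 'M[R]_(r i))
  (hT_unit : forall d, D d -> forall i, T (@freq R m d) i \in unitmx)
  (hT : forall d, D d -> forall i,
     T (@freq R m d) i *m companion (a (@freq R m d) i)
       - M i *m T (@freq R m d) i = N i *m first_row R (r i))
  (* dynamic control law for the augmented system, of class C^p *)
  (p : nat) (hp : (0 < p)%N) (nchi : nat)
  (h : reg_arg R nchi -> 'cV[R]_3) (k : reg_arg R nchi -> 'cV[R]_nchi)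
  (hh : classC p h) (hk : classC p k)
  (hstab : stabilizes_augmented P qd mu L0 L1 M N h k D T) :
  solves_attitude_tracking p P D qd
    (@law_out R nchi r L0 h) (@law_dyn R nchi r L0 M N h k).
Proof.
split; [exact: classC_law_out|exact: classC_law_dyn|].
move=> d Dd q0 w0 eta0 zeta0 chi0 q0u.
have th_deriv := path_theta hr (ha_ode d Dd) (hT d Dd).
have th_out := PsiTinv_theta hr d (hT_unit d Dd).
have [ex_sol sol_stable] :=
  hstab d Dd q0 w0 eta0 zeta0 (usubmx chi0) (dsubmx chi0) q0u.
split.
  have [y [ysol [[y_err y_vel] y_mode y_rate y_vc [y_v y_chi]]]] := ex_sol.
  exists (plant_of qd y), (state_of y); split.
    apply: (plant_of_closed_loop hL th_deriv th_out hqd ysol).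
    by rewrite y_vc y_v y_vel y_rate.
  split=> //=; first by rewrite y_err quat_errK.
  by rewrite /state_of y_v y_chi vsubmxK.
move=> x chi [xsol [x_q x_w x_eta x_zeta x_chi]].
have [|[b_err b_w b_eta b_zeta] [[_ b_v b_chi] [lim_q lim_w lim_eta]]] :=
    sol_stable (augment P qd N (theta d (T (@freq R m d))) x chi).
  split; first exact: (augment_closed_loop hL th_deriv th_out xsol).
  by split; rewrite /= ?x_q ?x_w ?x_eta ?x_zeta ?x_chi.
split; last by split.
split=> //.
- have := bounded_path_linear (linear_quat_err (quat_conj qd)) b_err.
  by congr bounded_path; apply/funext => t; exact: quat_errK.
- have := bounded_path_col_mx b_v b_chi.
  by congr bounded_path; apply/funext => t; exact: vsubmxK.
Qed.
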